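(* Let $\Sigma$ be a theory (a set of sentences closed under classical first-order consequence) in the language $\mathcal{L}_T$ that extends Robinson arithmetic $Q$, represents the function $f$ by the function symbol $f^\bullet$ (and likewise the functions denoted by $\ulcorner\phi(\dot x)\urcorner$), and is closed under the rule $$(T\text{-Intro})\qquad \text{from } \phi \text{ infer } T\ulcorner\phi\urcorner \qquad(\phi \text{ an } \mathcal{L}_T\text{-sentence}).$$ Suppose that $\Sigma$ proves, for all $\mathcal{L}_T$-sentences $\phi,\psi$, $$(T\text{-Imp})\qquad T\ulcorner\phi\rightarrow\psi\urcorner\rightarrow(T\ulcorner\phi\urcorner\rightarrow T\ulcorner\psi\urcorner),$$ and, for all $\mathcal{L}_T$-formulas $\phi(v)$ with at most the variable $v$ free, $$(\text{UInf})\qquad \forall x\, T\ulcorner\phi(\dot x)\urcorner\rightarrow T\ulcorner\forall v\,\phi(v)\urcorner.$$ Let $T^\omega x$ be the formula $\forall y\, T f^\bullet(y,x)$. Then for every $\mathcal{L}_T$-sentence $\phi$: (i) if $\Sigma\vdash_\omega T^\omega\ulcorner\phi\urcorner\rightarrow\phi$, then $\Sigma\vdash_\omega\phi$; (ii) $\Sigma\vdash_\omega T^\omega\ulcorner T^\omega\ulcorner\phi\urcorner\rightarrow\phi\urcorner\rightarrow T^\omega\ulcorner\phi\urcorner$.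
   Context: $\mathcal{L}$ is a standard language of arithmetic, except that it is assumed to contain certain additional function symbols (specified below). $\mathcal{L}_T$ is the extension of $\mathcal{L}$ by one unary predicate symbol $T$. A standard coding (Gödel numbering) of the expressions of $\mathcal{L}_T$ is fixed. $\overline n$ is the numeral of the natural number $n$, and $\ulcorner\eta\urcorner$ is the name (numeral) of the code of the expression $\eta$. For a formula $\phi(v)$, $\ulcorner\phi(\dot x)\urcorner$ is a term with free variable $x$ denoting the function that maps $n$ to the code of the sentence $\phi(\overline n)$. This function is represented in the theory: for each $n$, the theory proves that the value of the term at $\overline n$ equals $\ulcorner\phi(\overline n)\urcorner$. $f$ is a two-place primitive recursive function which, applied to a natural number $n$ and the code of a sentence $\phi$, yields the code of the sentence $T\ulcorner\cdots T\ulcorner\phi\urcorner\cdots\urcorner$ with $n$ applications of $T$. That is, $f(0,\#\phi)=\#\phi$, and $f(n+1,\#\phi)$ is the code of $T\ulcorner\chi\urcorner$, where $\chi$ is the sentence with code $f(n,\#\phi)$; here $\#\phi$ is the code of $\phi$. $f^\bullet$ is a function symbol of $\mathcal{L}$ representing $f$ in the theory: for all $n,m$, the theory proves $f^\bullet(\overline n,\overline m)=\overline{f(n,m)}$. The $\omega$-rule infers $\forall x\,\psi(x)$ from the premises $\psi(\overline n)$ for all $n\in\omega$. The relation $\vdash_\omega$ is the closure of classical derivability under non-embedded (that is, non-nested) applications of the $\omega$-rule: $\Sigma\vdash_\omega\phi$ iff $\phi$ is derivable in classical first-order logic from $\Sigma$ together with all sentences $\forall x\,\psi(x)$ such that $\Sigma\vdash\psi(\overline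 n)$ for every $n\in\omega$.
   Formalization: The terms ⌜φ(ẋ)⌝ are required to be uniform in φ: all come from one term sub(u,x) by putting the name ⌜φ⌝ for u (the usual dot notation). With unrelated terms for different φ, each correct only at numerals, claim (i) can fail. *)

(* Defs.v *)
(* First-order arithmetic with a truth predicate, over the Stdlib. *)
From Stdlib Require Import Arith Cantor List.
From Stdlib Require Vector Fin.

Set Implicit Arguments.

(* ------------------------------------------------------------------------ *)
(** * Syntax *)

(* The function symbols of the language besides 0, S, + and *; [sym k] is the
   set of the k-place ones, each with a number used in the Goedel numbering. *)
Record signature : Type := {
  sym : nat -> Type;
  sym_code : forall k, sym k -> nat;
  sym_code_inj : forall k (g h : sym k), sym_code g = sym_code h -> g = h
}.

Arguments sym_code {s k} _.

(* Variables are de Bruijn indices. *)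
Inductive term (L : signature) : Type :=
| Var : nat -> term L
| Zero : term L
| Succ : term L -> term L
| Plus : term L -> term L -> term L
| Mult : term L -> term L -> term L
| Fn : forall k, sym L k -> Vector.t (term L) k -> term L.

Arguments Var {L} _.
Arguments Zero {L}.
Arguments Fn {L k} _ _.

Inductive form (L : signature) : Type :=
| Bot : form L
| Eq : term L -> term L -> form L
| Tr : term L -> form L
| Imp : form L -> form L -> form L
| All : form L -> form L.

Arguments Bot {L}.

Definition Neg {L} (phi : form L) : form L := Imp phi Bot.
Definition Ex {L} (phi : form L) : form L := Neg (All (Neg phi)).

Definition Fn2 {L} (g : sym L 2) (t u : term L) : term L :=
  Fn g (Vector.cons _ t _ (Vector.cons _ u _ (Vector.nil _))).

Fixpoint subst_t {L} (s : nat -> term L) (t : term L) : term L :=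
  match t with
  | Var x => s x
  | Zero => Zero
  | Succ t => Succ (subst_t s t)
  | Plus t u => Plus (subst_t s t) (subst_t s u)
  | Mult t u => Mult (subst_t s t) (subst_t s u)
  | Fn g ts => Fn g (Vector.map (subst_t s) ts)
  end.

Definition shift_t {L} (t : term L) : term L := subst_t (fun x => Var (S x)) t.

Definition scons {X} (a : X) (s : nat -> X) : nat -> X :=
  fun x => match x with 0 => a | S y => s y end.

Definition up {L} (s : nat -> term L) : nat -> term L :=
  scons (Var 0) (fun x => shift_t (s x)).

Fixpoint subst {L} (s : nat -> term L) (phi : form L) : form L :=
  match phi with
  | Bot => Bot
  | Eq t u => Eq (subst_t s t) (subst_t s u)
  | Tr t => Tr (subst_t s t)
  | Imp phi psi => Imp (subst s phi) (subst s psi)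
  | All phi => All (subst (up s) phi)
  end.

Definition shift {L} (phi : form L) : form L := subst (fun x => Var (S x)) phi.

(* [inst t phi] is phi(t) for phi(v), v being variable 0. *)
Definition inst_t {L} (t u : term L) : term L := subst_t (scons t Var) u.
Definition inst {L} (t : term L) (phi : form L) : form L :=
  subst (scons t Var) phi.

(* Every free variable has index below n. *)
Fixpoint bounded_t {L} (n : nat) (t : term L) : Prop :=
  match t with
  | Var x => x < n
  | Zero => True
  | Succ t => bounded_t n t
  | Plus t u | Mult t u => bounded_t n t /\ bounded_t n u
  | Fn _ ts => Vector.fold_right (fun t P => bounded_t n t /\ P) ts True
  end.

Fixpoint bounded {L} (n : nat) (phi : form L) : Prop :=
  match phi with
  | Bot => True
  | Eq t u => bounded_t n t /\ bounded_t n u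
  | Tr t => bounded_t n t
  | Imp phi psi => bounded n phi /\ bounded n psi
  | All phi => bounded (S n) phi
  end.

Definition sentence {L} (phi : form L) : Prop := bounded 0 phi.

(* ------------------------------------------------------------------------ *)
(** * Numerals and Goedel numbering *)

Fixpoint num {L} (n : nat) : term L :=
  match n with 0 => Zero | S n => Succ (num n) end.

Definition pair (a b : nat) : nat := Cantor.to_nat (a, b).

Fixpoint code_t {L} (t : term L) : nat :=
  match t with
  | Var x => pair 0 x
  | Zero => pair 1 0
  | Succ t => pair 2 (code_t t)
  | Plus t u => pair 3 (pair (code_t t) (code_t u))
  | Mult t u => pair 4 (pair (code_t t) (code_t u))
  | @Fn _ k g ts =>
      pair 5 (pair k (pair (sym_code g)
        (Vector.fold_right (fun t c => pair (code_t t) c) ts 0)))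
  end.

Fixpoint code {L} (phi : form L) : nat :=
  match phi with
  | Bot => pair 6 0
  | Eq t u => pair 7 (pair (code_t t) (code_t u))
  | Tr t => pair 8 (code_t t)
  | Imp phi psi => pair 9 (pair (code phi) (code psi))
  | All phi => pair 10 (code phi)
  end.

Definition quote {L} (phi : form L) : term L := num (code phi).

(* Feferman's dot notation. The term [sub], in the variables 0 and 1, is meant
   to denote the function taking the code of phi(v) and n to the code of
   phi(num n); inserting the name of phi for variable 0 leaves a term whose
   only free variable is (again) variable 0. *)
Definition dot {L} (sub : term L) (phi : form L) : term L :=
  subst_t (scons (quote phi) Var) sub.

(* ------------------------------------------------------------------------ *)
(** * Classical derivability *)

Inductive prv {L} : list (form L) -> form L -> Prop :=
| Ax A phi : In phi A -> prv A phi
| ImpI A phi psi : prv (phi :: A) psi -> prv A (Imp phi psi)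
| ImpE A phi psi : prv A (Imp phi psi) -> prv A phi -> prv A psi
| AllI A phi : prv (map shift A) phi -> prv A (All phi)
| AllE A phi t : prv A (All phi) -> prv A (inst t phi)
| Raa A phi : prv (Neg phi :: A) Bot -> prv A phi
| EqRefl A t : prv A (Eq t t)
| EqElim A t u phi : prv A (Eq t u) -> prv A (inst t phi) -> prv A (inst u phi).

Definition proves {L} (Sigma : form L -> Prop) (phi : form L) : Prop :=
  exists A, (forall psi, In psi A -> Sigma psi) /\ prv A phi.

Definition theory {L} (Sigma : form L -> Prop) : Prop :=
  (forall phi, Sigma phi -> sentence phi) /\
  (forall phi, sentence phi -> proves Sigma phi -> Sigma phi).

(* Sigma together with the conclusions of the omega-rule applied to theorems
   of Sigma. *)
Inductive omega_ext {L} (Sigma : form L -> Prop) : form L -> Prop :=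
| omega_base phi : Sigma phi -> omega_ext Sigma phi
| omega_rule psi :
    bounded 1 psi -> (forall n, proves Sigma (inst (num n) psi)) ->
    omega_ext Sigma (All psi).

Definition proves_omega {L} (Sigma : form L -> Prop) (phi : form L) : Prop :=
  proves (omega_ext Sigma) phi.

(* ------------------------------------------------------------------------ *)
(** * Robinson arithmetic *)

(* Under two quantifiers, variable 1 is the outer and variable 0 the inner. *)
Inductive Q {L} : form L -> Prop :=
| Q_succ_zero : Q (All (Neg (Eq (Succ (Var 0)) Zero)))
| Q_succ_inj :
    Q (All (All (Imp (Eq (Succ (Var 1)) (Succ (Var 0))) (Eq (Var 1) (Var 0)))))
| Q_pred :
    Q (All (Imp (Neg (Eq (Var 0) Zero)) (Ex (Eq (Var 1) (Succ (Var 0))))))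
| Q_plus_zero : Q (All (Eq (Plus (Var 0) Zero) (Var 0)))
| Q_plus_succ :
    Q (All (All (Eq (Plus (Var 1) (Succ (Var 0))) (Succ (Plus (Var 1) (Var 0))))))
| Q_mult_zero : Q (All (Eq (Mult (Var 0) Zero) Zero))
| Q_mult_succ :
    Q (All (All (Eq (Mult (Var 1) (Succ (Var 0)))
                    (Plus (Mult (Var 1) (Var 0)) (Var 1))))).

(* ------------------------------------------------------------------------ *)
(** * Iterated truth *)

Inductive primrec : forall k, (Vector.t nat k -> nat) -> Prop :=
| pr_zero k : @primrec k (fun _ => 0)
| pr_succ : @primrec 1 (fun v => S (Vector.hd v))
| pr_proj k (i : Fin.t k) : @primrec k (fun v => Vector.nth v i)
| pr_comp k m (g : Vector.t nat m -> nat)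
    (hs : Vector.t (Vector.t nat k -> nat) m) :
    primrec g -> (forall i, primrec (Vector.nth hs i)) ->
    primrec (fun v => g (Vector.map (fun h => h v) hs))
| pr_rec k (g : Vector.t nat k -> nat) (h : Vector.t nat (S (S k)) -> nat) :
    primrec g -> primrec h ->
    @primrec (S k) (fun v =>
      nat_rect (fun _ => nat) (g (Vector.tl v))
        (fun n r => h (Vector.cons _ n _ (Vector.cons _ r _ (Vector.tl v))))
        (Vector.hd v))
| pr_ext k (g h : Vector.t nat k -> nat) :
    (forall v, g v = h v) -> primrec g -> primrec h.

Definition primrec2 (f : nat -> nat -> nat) : Prop :=
  @primrec 2 (fun v => f (Vector.hd v) (Vector.hd (Vector.tl v))).

(* f n (code phi) is the code of phi prefixed by n applications of T. The
   values of f at numbers that do not code sentences are left open. *)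
Definition iterates_truth (L : signature) (f : nat -> nat -> nat) : Prop :=
  (forall phi : form L, sentence phi -> f 0 (code phi) = code phi) /\
  (forall (n : nat) (phi chi : form L), sentence phi -> sentence chi ->
     f n (code phi) = code chi -> f (S n) (code phi) = code (Tr (quote chi))).

(* T^omega t, that is, forall y, T (f_sym (y, t)). *)
Definition Tomega {L} (f_sym : sym L 2) (t : term L) : form L :=
  All (Tr (Fn2 f_sym (Var 0) (shift_t t))).

(* Main.v *)
(* Write box phi for T^omega of the quotation of phi. Both claims are Loeb's
   theorem for box, once box satisfies the derivability conditions for provability
   under the omega-rule. T-Intro covers Sigma only, and necessitation for box asks
   for T^n phi for all n at once, with the omega-rule unnested. So for a formula A
   all of whose instances are provable in Sigma, let psi(p) say, by
   self-reference, that A(p) holds and that psi(q) is true if p = q + 1. By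
   induction on p, Sigma proves each instance of psi, so one application of the
   omega-rule yields rho := forall p, psi(p). By UInf, Sigma proves rho -> T rho,
   hence rho -> T^n (forall p, A(p)) for every n, and a second application
   collects these into rho -> box (forall p, A(p)). *)
From Stdlib Require Import Arith Lia Cantor List.
From Stdlib Require Vector.
Require Import Defs.

(** * Substitution *)

(** The arguments of [Fn] are nested in a vector; the inner fixpoint walks along it, so that the
    case of [Fn] gets a hypothesis for every argument. *)
Fixpoint term_nested_ind (L : signature) (P : term L -> Prop)
  (HV : forall x, P (Var x)) (H0 : P Zero)
  (HS : forall t, P t -> P (Succ t))
  (HP : forall t u, P t -> P u -> P (Plus t u))
  (HM : forall t u, P t -> P u -> P (Mult t u))
  (HF : forall k (g : sym L k) ts, Vector.Forall P ts -> P (Fn g ts))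
  (t : term L) {struct t} : P t :=
  let rec := term_nested_ind L P HV H0 HS HP HM HF in
  match t with
  | Var x => HV x
  | Zero => H0
  | Succ t => HS t (rec t)
  | Plus t u => HP t u (rec t) (rec u)
  | Mult t u => HM t u (rec t) (rec u)
  | Fn g ts =>
      HF _ g ts
        ((fix all k (v : Vector.t (term L) k) : Vector.Forall P v :=
            match v with
            | Vector.nil _ => Vector.Forall_nil P
            | Vector.cons _ t _ v => Vector.Forall_cons P t v (rec t) (all _ v)
            end) _ ts)
  end.

Section Substitution.

Context {L : signature}.
Implicit Types (t u : term L) (phi psi : form L) (s r : nat -> term L).

Lemma subst_t_agree n t s r :
  bounded_t n t -> (forall x, x < n -> s x = r x) ->
  subst_t s t = subst_t r t.
Proof.
  intros Ht Hsr; induction t as [| |t IH|t u IHt IHu|t u IHt IHu|k g ts Hall]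
    using term_nested_ind; simpl in *; auto.
  - rewrite IH; auto.
  - destruct Ht; rewrite IHt, IHu; auto.
  - destruct Ht; rewrite IHt, IHu; auto.
  - f_equal; clear g; induction Hall as [|k t ts IH _ IHs]; simpl in *; [easy|].
    destruct Ht; rewrite IH, IHs; auto.
Qed.

Lemma subst_t_comp s r t :
  subst_t s (subst_t r t) = subst_t (fun x => subst_t s (r x)) t.
Proof.
  induction t using term_nested_ind; simpl; try congruence.
  f_equal; rewrite Vector.map_map.
  clear g; induction H as [|k t ts IH _ IHs]; simpl; [easy|]; now rewrite IH, IHs.
Qed.

Lemma subst_t_Var t : subst_t Var t = t.
Proof.
  induction t using term_nested_ind; simpl; try congruence.
  f_equal; clear g; induction H as [|k t ts IH _ IHs]; simpl; [easy|]; now rewrite IH, IHs.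
Qed.

Lemma subst_t_id n s t :
  bounded_t n t -> (forall x, x < n -> s x = Var x) -> subst_t s t = t.
Proof. intros Ht Hs; rewrite <- (subst_t_Var t) at 2; now apply (subst_t_agree n). Qed.

Lemma subst_t_closed s t : bounded_t 0 t -> subst_t s t = t.
Proof. intros Ht; apply (subst_t_id 0); [easy|lia]. Qed.

Lemma bounded_subst_t n m s t :
  bounded_t n t -> (forall x, x < n -> bounded_t m (s x)) ->
  bounded_t m (subst_t s t).
Proof.
  intros Ht Hs; induction t as [| |t IH|t u IHt IHu|t u IHt IHu|k g ts Hall]
    using term_nested_ind; simpl in *; intuition.
  clear g; induction Hall as [|k t ts IH _ IHs]; simpl in *; intuition.
Qed.

Lemma subst_id n phi s :
  bounded n phi -> (forall x, x < n -> s x = Var x) -> subst s phi = phi.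
Proof.
  revert n s; induction phi; simpl; intros n s Hb Hs; auto.
  - destruct Hb; f_equal; now apply (subst_t_id n).
  - f_equal; now apply (subst_t_id n).
  - destruct Hb; f_equal; eauto.
  - f_equal; apply (IHphi (S n)); auto.
    intros [|x] Hx; simpl; auto; rewrite Hs; auto; lia.
Qed.

Lemma bounded_subst n m s phi :
  bounded n phi -> (forall x, x < n -> bounded_t m (s x)) ->
  bounded m (subst s phi).
Proof.
  revert n m s; induction phi; simpl; intros n m s Hb Hs; auto.
  - destruct Hb; split; now apply (bounded_subst_t n).
  - now apply (bounded_subst_t n).
  - destruct Hb; eauto.
  - apply (IHphi (S n)); auto.
    intros [|x] Hx; simpl; [lia|].
    apply (bounded_subst_t m); [apply Hs; lia|simpl; lia].
Qed.

Lemma bounded_t_mono n m t : n <= m -> bounded_t n t -> bounded_t m t.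
Proof.
  intros Hnm Ht; rewrite <- subst_t_Var.
  apply (bounded_subst_t n); simpl; auto; lia.
Qed.

Lemma bounded_mono n m phi : n <= m -> bounded n phi -> bounded m phi.
Proof.
  intros Hnm Hphi; rewrite <- (subst_id n phi Var); auto.
  apply (bounded_subst n); simpl; auto; lia.
Qed.

Lemma shift_sentence phi : sentence phi -> shift phi = phi.
Proof. intros H; apply (subst_id 0); [easy|lia]. Qed.

Lemma inst_sentence t phi : sentence phi -> inst t phi = phi.
Proof. intros H; apply (subst_id 0); [easy|lia]. Qed.

Lemma inst_Var0 phi : bounded 1 phi -> inst (Var 0) phi = phi.
Proof. intros H; apply (subst_id 1); auto; intros [|x]; simpl; auto; lia. Qed.

Lemma bounded_inst n t phi : bounded 1 phi -> bounded_t n t -> bounded n (inst t phi).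
Proof.
  intros; apply (bounded_subst 1); auto; intros [|x]; simpl; auto; lia.
Qed.

Lemma inst_t_shift_t t u : inst_t t (shift_t u) = u.
Proof. unfold inst_t, shift_t; rewrite subst_t_comp; apply subst_t_Var. Qed.

Lemma bounded_num n k : bounded_t n (num k : term L).
Proof. induction k; simpl; auto. Qed.

Lemma subst_t_num s k : subst_t s (num k) = num k.
Proof. apply subst_t_closed, bounded_num. Qed.

Lemma shift_t_num k : shift_t (num k : term L) = num k.
Proof. apply subst_t_num. Qed.

End Substitution.

(** * Derivability from a set of sentences *)

(** Local hypotheses are kept apart from axioms: when the axioms are sentences, generalization has
    to shift [G] alone. For empty [G] this is convertible with [proves]. *)
Definition ded {L} (S : form L -> Prop) (G : list (form L)) (phi : form L) : Prop :=
  exists A, (forall psi, In psi A -> S psi) /\ prv (G ++ A) phi.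

Definition And {L} (phi psi : form L) : form L := Neg (Imp phi (Neg psi)).

Lemma prv_weaken {L} (A B : list (form L)) phi : prv A phi -> incl A B -> prv B phi.
Proof.
  intros H; revert B; induction H; intros B HB.
  - now apply Ax, HB.
  - apply ImpI, IHprv, incl_cons; [now left|now apply incl_tl].
  - eapply ImpE; eauto.
  - apply AllI, IHprv, incl_map, HB.
  - apply AllE; auto.
  - apply Raa, IHprv, incl_cons; [now left|now apply incl_tl].
  - apply EqRefl.
  - eapply EqElim; eauto.
Qed.

Section Deduction.

Context {L : signature} {S : form L -> Prop}.
Context (HS : forall phi, S phi -> sentence phi).
Implicit Types (G D : list (form L)) (t u x y z : term L) (phi psi : form L).

Lemma map_shift_sentences G : Forall sentence G -> map shift G = G.
Proof.
  induction 1; simpl; [easy|]; rewrite shift_sentence; congruence.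
Qed.

Lemma ded_ax G phi : In phi G -> ded S G phi.
Proof. exists nil; split; [easy|]; apply Ax, in_or_app; auto. Qed.

Lemma ded_base G phi : S phi -> ded S G phi.
Proof.
  exists (phi :: nil); split; [intros psi [<-|[]]; auto|].
  apply Ax, in_or_app; simpl; auto.
Qed.

Lemma ded_weaken G D phi : ded S G phi -> incl G D -> ded S D phi.
Proof.
  intros (A & HA & H) HGD; exists A; split; auto.
  apply (prv_weaken _ _ _ H), incl_app; auto using incl_appr, incl_refl, incl_appl.
Qed.

Lemma ded_nil G phi : ded S nil phi -> ded S G phi.
Proof. intros H; apply (ded_weaken nil); [easy|apply incl_nil_l]. Qed.

Lemma ded_impI G phi psi : ded S (phi :: G) psi -> ded S G (Imp phi psi).
Proof. intros (A & HA & H); exists A; split; auto; now apply ImpI. Qed.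

Lemma ded_impE G phi psi : ded S G (Imp phi psi) -> ded S G phi -> ded S G psi.
Proof.
  intros (A & HA & H) (B & HB & H'); exists (A ++ B); split.
  - intros chi [|]%in_app_or; auto.
  - apply ImpE with phi; [apply (prv_weaken _ _ _ H)|apply (prv_weaken _ _ _ H')];
      intros chi; rewrite !in_app_iff; tauto.
Qed.

Lemma ded_raa G phi : ded S (Neg phi :: G) Bot -> ded S G phi.
Proof. intros (A & HA & H); exists A; split; auto; now apply Raa. Qed.

Lemma ded_allI G phi : ded S (map shift G) phi -> ded S G (All phi).
Proof.
  intros (A & HA & H); exists A; split; auto; apply AllI.
  rewrite map_app, (map_shift_sentences A); auto.
  apply Forall_forall; auto.
Qed.

Lemma ded_allI_closed G phi : Forall sentence G -> ded S G phi -> ded S G (All phi).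
Proof. intros HG H; apply ded_allI; now rewrite map_shift_sentences. Qed.

Lemma ded_allE G phi t : ded S G (All phi) -> ded S G (inst t phi).
Proof. intros (A & HA & H); exists A; split; auto; now apply AllE. Qed.

Lemma ded_refl G t : ded S G (Eq t t).
Proof. exists nil; split; [easy|apply EqRefl]. Qed.

Lemma ded_rewrite G t u phi : ded S G (Eq t u) -> ded S G (inst t phi) -> ded S G (inst u phi).
Proof.
  intros (A & HA & H) (B & HB & H'); exists (A ++ B); split.
  - intros chi [|]%in_app_or; auto.
  - apply EqElim with t; [apply (prv_weaken _ _ _ H)|apply (prv_weaken _ _ _ H')];
      intros chi; rewrite !in_app_iff; tauto.
Qed.

Lemma ded_cut G phi psi : ded S G phi -> ded S (phi :: G) psi -> ded S G psi.
Proof. intros H H'; apply ded_impE with phi; auto using ded_impI. Qed.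

Lemma ded_mp G phi psi : ded S nil (Imp phi psi) -> ded S G phi -> ded S G psi.
Proof. intros H; apply ded_impE; now apply ded_nil. Qed.

Lemma ded_exfalso G phi : ded S G Bot -> ded S G phi.
Proof. intros H; apply ded_raa, (ded_weaken G); auto using incl_tl, incl_refl. Qed.

Lemma ded_and G phi psi : ded S G phi -> ded S G psi -> ded S G (And phi psi).
Proof.
  intros H H'; apply ded_impI; apply ded_impE with psi.
  - apply ded_impE with phi; [now apply ded_ax; left|].
    apply (ded_weaken G); auto using incl_tl, incl_refl.
  - apply (ded_weaken G); auto using incl_tl, incl_refl.
Qed.

Lemma ded_and_l G phi psi : ded S G (And phi psi) -> ded S G phi.
Proof.
  intros H; apply ded_raa, ded_impE with (Imp phi (Neg psi)).
  - apply (ded_weaken G); auto using incl_tl, incl_refl.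
  - apply ded_impI, ded_exfalso, ded_impE with phi; apply ded_ax; simpl; auto.
Qed.

Lemma ded_and_r G phi psi : ded S G (And phi psi) -> ded S G psi.
Proof.
  intros H; apply ded_raa, ded_impE with (Imp phi (Neg psi)).
  - apply (ded_weaken G); auto using incl_tl, incl_refl.
  - apply ded_impI, ded_ax; simpl; auto.
Qed.

(** Replacement in v = t, with t shifted so that instantiating v leaves it alone. The congruences
    below choose their contexts in the same way. *)
Lemma ded_sym G t u : ded S G (Eq t u) -> ded S G (Eq u t).
Proof.
  intros H; generalize (ded_rewrite G t u (Eq (Var 0) (shift_t t)) H).
  unfold inst; simpl; fold (inst_t t (shift_t t)); fold (inst_t u (shift_t t)).
  rewrite !inst_t_shift_t; auto using ded_refl.
Qed.

Lemma ded_trans G t u x : ded S G (Eq t u) -> ded S G (Eq u x) -> ded S G (Eq t x).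
Proof.
  intros H H'; generalize (ded_rewrite G u x (Eq (shift_t t) (Var 0)) H').
  unfold inst; simpl; fold (inst_t u (shift_t t)); fold (inst_t x (shift_t t)).
  rewrite !inst_t_shift_t; auto.
Qed.

Lemma ded_congr G t u r : ded S G (Eq t u) -> ded S G (Eq (inst_t t r) (inst_t u r)).
Proof.
  intros H; generalize (ded_rewrite G t u (Eq (shift_t (inst_t t r)) r) H).
  unfold inst; simpl.
  fold (inst_t t (shift_t (inst_t t r))); fold (inst_t u (shift_t (inst_t t r))).
  fold (inst_t t r); fold (inst_t u r).
  rewrite !inst_t_shift_t; auto using ded_refl.
Qed.

Lemma ded_Tr G t u : ded S G (Eq t u) -> ded S G (Tr t) -> ded S G (Tr u).
Proof. apply (ded_rewrite G t u (Tr (Var 0))). Qed.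

Lemma ded_Succ G t u : ded S G (Eq t u) -> ded S G (Eq (Succ t) (Succ u)).
Proof. apply (ded_congr G t u (Succ (Var 0))). Qed.

Lemma ded_Plus G t t' u u' :
  ded S G (Eq t t') -> ded S G (Eq u u') -> ded S G (Eq (Plus t u) (Plus t' u')).
Proof.
  intros H H'; apply ded_trans with (Plus t' u).
  - generalize (ded_congr G t t' (Plus (Var 0) (shift_t u)) H).
    unfold inst_t; simpl; fold (inst_t t (shift_t u)); fold (inst_t t' (shift_t u)).
    now rewrite !inst_t_shift_t.
  - generalize (ded_congr G u u' (Plus (shift_t t') (Var 0)) H').
    unfold inst_t; simpl; fold (inst_t u (shift_t t')); fold (inst_t u' (shift_t t')).
    now rewrite !inst_t_shift_t.
Qed.

Lemma ded_Mult G t t' u u' :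
  ded S G (Eq t t') -> ded S G (Eq u u') -> ded S G (Eq (Mult t u) (Mult t' u')).
Proof.
  intros H H'; apply ded_trans with (Mult t' u).
  - generalize (ded_congr G t t' (Mult (Var 0) (shift_t u)) H).
    unfold inst_t; simpl; fold (inst_t t (shift_t u)); fold (inst_t t' (shift_t u)).
    now rewrite !inst_t_shift_t.
  - generalize (ded_congr G u u' (Mult (shift_t t') (Var 0)) H').
    unfold inst_t; simpl; fold (inst_t u (shift_t t')); fold (inst_t u' (shift_t t')).
    now rewrite !inst_t_shift_t.
Qed.

End Deduction.

(** * Arithmetic in Q *)

(** The disjunction of x = 0, ..., x = n, with disjunction rendered by negation and implication. It
    stands in for x <= n. *)
Fixpoint upto {L} (n : nat) (x : term L) : form L :=
  match n with
  | 0 => Eq x Zero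
  | S m => Imp (Neg (upto m x)) (Eq x (num (S m)))
  end.

(* By [to_nat_spec], for x and w numerals this says that w = pair 10 x, that
   is, that w codes All psi if x codes psi. The last two summands allow
   Robinson arithmetic to bound x. *)
Definition body_poly {L} (x : term L) : term L :=
  Plus (Plus (Mult (Plus x (num 10)) (Succ (Plus x (num 10)))) x) x.

Definition body_code {L} (x w : term L) : form L := Eq (body_poly x) (Plus w w).

Section Arithmetic.

Context {L : signature} {S : form L -> Prop}.
Context (HS : forall phi, S phi -> sentence phi).
Context (HQ : forall phi, Q phi -> S phi).
Implicit Types (G : list (form L)) (t u x y z w : term L) (phi psi : form L).

Lemma Q_base G phi : Q phi -> ded S G phi.
Proof. intros; now apply ded_base, HQ. Qed.

Ltac fold_inst :=
  repeat match goal with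
  | |- context [subst_t (scons ?t Var) ?u] =>
      change (subst_t (scons t Var) u) with (inst_t t u)
  end.

Lemma ded_succ_zero G t : ded S G (Eq (Succ t) Zero) -> ded S G Bot.
Proof. apply ded_impE. exact (ded_allE _ _ t (Q_base G _ Q_succ_zero)). Qed.

Lemma ded_succ_inj G t u : ded S G (Eq (Succ t) (Succ u)) -> ded S G (Eq t u).
Proof.
  generalize (ded_allE _ _ u (ded_allE _ _ t (Q_base G _ Q_succ_inj))).
  unfold inst; simpl; fold_inst; rewrite inst_t_shift_t; apply ded_impE.
Qed.

Lemma ded_plus_zero G t : ded S G (Eq (Plus t Zero) t).
Proof. exact (ded_allE _ _ t (Q_base G _ Q_plus_zero)). Qed.

Lemma ded_plus_succ G t u : ded S G (Eq (Plus t (Succ u)) (Succ (Plus t u))).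
Proof.
  generalize (ded_allE _ _ u (ded_allE _ _ t (Q_base G _ Q_plus_succ))).
  unfold inst; simpl; fold_inst; now rewrite inst_t_shift_t.
Qed.

Lemma ded_mult_zero G t : ded S G (Eq (Mult t Zero) Zero).
Proof. exact (ded_allE _ _ t (Q_base G _ Q_mult_zero)). Qed.

Lemma ded_mult_succ G t u : ded S G (Eq (Mult t (Succ u)) (Plus (Mult t u) t)).
Proof.
  generalize (ded_allE _ _ u (ded_allE _ _ t (Q_base G _ Q_mult_succ))).
  unfold inst; simpl; fold_inst; now rewrite inst_t_shift_t.
Qed.

(** By contradiction from [Q_pred], since [Ex] is a negated universal; in the second premise the
    predecessor is the fresh variable 0. *)
Lemma ded_zero_or_succ G x phi :
  ded S (Eq x Zero :: G) phi ->
  ded S (Eq (shift_t x) (Succ (Var 0)) :: map shift G) (shift phi) ->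
  ded S G phi.
Proof.
  intros H0 HSucc; apply ded_raa.
  apply ded_impE with (All (Neg (Eq (shift_t x) (Succ (Var 0))))).
  - generalize (ded_allE _ _ x (Q_base (Neg phi :: G) _ Q_pred)).
    unfold inst; simpl; intros H; apply (ded_impE _ _ _ H).
    apply ded_impI, ded_impE with phi; [now apply ded_ax; simpl; auto|].
    apply (ded_weaken _ _ _ H0); intros psi; simpl; tauto.
  - apply (ded_allI HS), ded_impI; simpl.
    apply ded_impE with (shift phi); [now apply ded_ax; simpl; auto|].
    apply (ded_weaken _ _ _ HSucc); intros psi; simpl; tauto.
Qed.

Lemma ded_num_plus G m n : ded S G (Eq (Plus (num m) (num n)) (num (m + n))).
Proof.
  induction n as [|n IH]; simpl.
  - rewrite <- plus_n_O; apply ded_plus_zero.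
  - rewrite <- plus_n_Sm; simpl.
    eapply ded_trans; [apply ded_plus_succ|now apply ded_Succ].
Qed.

Lemma ded_num_mult G m n : ded S G (Eq (Mult (num m) (num n)) (num (m * n))).
Proof.
  induction n as [|n IH]; simpl.
  - rewrite <- mult_n_O; apply ded_mult_zero.
  - rewrite <- mult_n_Sm.
    eapply ded_trans; [apply ded_mult_succ|].
    eapply ded_trans; [apply ded_Plus; [apply IH|apply ded_refl]|apply ded_num_plus].
Qed.

Lemma ded_num_neq G m n : m <> n -> ded S G (Eq (num m) (num n)) -> ded S G Bot.
Proof.
  revert n; induction m as [|m IH]; intros [|n] Hmn H; simpl in H; [easy| | |].
  - now apply (ded_succ_zero G (num n)), ded_sym.
  - now apply (ded_succ_zero G (num m)).
  - apply (IH n); [congruence|now apply ded_succ_inj].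
Qed.

(** * Bounds and finite case analysis *)

Lemma shift_upto n x : shift (upto n x) = upto n (shift_t x).
Proof.
  induction n as [|n IH]; [easy|]; simpl.
  unfold shift in *; simpl; now rewrite IH, subst_t_num.
Qed.

Lemma ded_upto_intro G m n x :
  m <= n -> ded S G (Eq x (num m)) -> ded S G (upto n x).
Proof.
  intros Hmn; induction n as [|n IH]; intros H; simpl.
  - now replace m with 0 in H by lia.
  - apply ded_impI.
    destruct (Nat.eq_dec m (Datatypes.S n)) as [->|].
    + apply (ded_weaken _ _ _ H), incl_tl, incl_refl.
    + apply ded_exfalso, ded_impE with (upto n x); [now apply ded_ax; left|].
      apply (ded_weaken G); [apply IH; auto; lia|apply incl_tl, incl_refl].
Qed.

Lemma ded_upto_elim G n x phi :
  ded S G (upto n x) ->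
  (forall m, m <= n -> ded S (Eq x (num m) :: G) phi) -> ded S G phi.
Proof.
  revert G; induction n as [|n IH]; intros G H Hm.
  - now apply ded_cut with (Eq x Zero); [|apply (Hm 0)].
  - apply ded_raa, ded_impE with phi; [now apply ded_ax; left|].
    apply ded_cut with (Eq x (num (Datatypes.S n))).
    + apply ded_impE with (Neg (upto n x)).
      * apply (ded_weaken _ _ _ H), incl_tl, incl_refl.
      * apply ded_impI, ded_impE with phi; [now apply ded_ax; simpl; auto|].
        apply IH; [now apply ded_ax; left|].
        intros m Hmn; apply (ded_weaken (Eq x (num m) :: G)); [apply Hm; lia|].
        intros psi; simpl; tauto.
    + apply (ded_weaken (Eq x (num (Datatypes.S n)) :: G)); [now apply Hm|].
      intros psi; simpl; tauto.
Qed.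

Lemma ded_plus_eq_succ G x y z w :
  ded S G (Eq (Plus z x) w) -> ded S G (Eq x (Succ y)) ->
  ded S G (Eq (Succ (Plus z y)) w).
Proof.
  intros H Hx; eapply ded_trans; [apply ded_sym, ded_plus_succ|].
  eapply ded_trans; [|exact H].
  apply ded_Plus; [apply ded_refl|now apply ded_sym].
Qed.

(** External induction on n, with a case split on x inside the theory. Addition in Q recurses on its
    right argument and is not known to commute, so the right summand is the one to bound, and
    [body_poly] ends in x. *)
Lemma ded_summand_upto G n z x : ded S (Eq (Plus z x) (num n) :: G) (upto n x).
Proof.
  revert G z x; induction n as [|n IH]; intros G z x;
    (apply ded_zero_or_succ with x;
     [apply (ded_upto_intro _ 0); [lia|now apply ded_ax; left]|]);
    simpl map; unfold shift at 1; simpl subst; rewrite ?subst_t_num.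
  (* [Var 0] is the predecessor y of x, and z + x = m becomes S (z + y) = m. *)
  all: match goal with |- ded S ?D (shift (upto ?m _)) =>
    assert (H : ded S D (Eq (Succ (Plus (shift_t z) (Var 0))) (num m)))
      by (apply ded_plus_eq_succ with (shift_t x); apply ded_ax; simpl; auto) end.
  - now apply ded_exfalso, ded_succ_zero with (Plus (shift_t z) (Var 0)).
  - rewrite shift_upto; apply ded_upto_elim with n (Var 0).
    { eapply ded_cut; [apply ded_succ_inj, H|apply IH]. }
    intros m Hm; apply ded_upto_intro with (Datatypes.S m); [lia|].
    apply ded_trans with (Succ (Var 0)); [now apply ded_ax; simpl; auto|].
    now apply (ded_Succ _ (Var 0) (num m)), ded_ax; left.
Qed.

Lemma ded_body_poly G x m :
  ded S G (Eq x (num m)) ->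
  ded S G (Eq (body_poly x) (num ((m + 10) * Datatypes.S (m + 10) + m + m))).
Proof.
  intros Hx.
  assert (H10 : ded S G (Eq (Plus x (num 10)) (num (m + 10)))).
  { eapply ded_trans; [apply ded_Plus; [exact Hx|apply ded_refl]|apply ded_num_plus]. }
  eapply ded_trans; [|apply ded_num_plus]; apply ded_Plus; [|exact Hx].
  eapply ded_trans; [|apply ded_num_plus]; apply ded_Plus; [|exact Hx].
  eapply ded_trans; [|apply ded_num_mult].
  apply ded_Mult; [exact H10|now apply (ded_Succ _ _ (num (m + 10)))].
Qed.

Lemma ded_double_num G w n :
  ded S G (Eq w (num n)) -> ded S G (Eq (Plus w w) (num (n + n))).
Proof.
  intros Hw; eapply ded_trans; [|apply ded_num_plus]; now apply ded_Plus.
Qed.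

Lemma code_All phi :
  (code phi + 10) * Datatypes.S (code phi + 10) + code phi + code phi =
  code (All phi) + code (All phi).
Proof.
  change (code (All phi)) with (Cantor.to_nat (10, code phi)).
  generalize (Cantor.to_nat_spec 10 (code phi)); lia.
Qed.

Lemma ded_body_code_quote G w phi :
  ded S G (Eq w (quote (All phi))) -> ded S G (body_code (quote phi) w).
Proof.
  intros Hw; eapply ded_trans; [apply (ded_body_poly _ _ (code phi)), ded_refl|].
  rewrite code_All; now apply ded_sym, ded_double_num.
Qed.

(** Since x is a summand of its own polynomial, Q bounds it by a numeral and can test the finitely
    many candidates. The polynomial is strictly increasing, so any candidate other than [code phi]
    would equate two distinct numerals. *)
Lemma ded_body_code_unique G x w phi :
  ded S G (Eq w (quote (All phi))) -> ded S G (body_code x w) ->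
  ded S G (Eq x (quote phi)).
Proof.
  intros Hw H.
  assert (Hx : ded S G (Eq (body_poly x) (num (code (All phi) + code (All phi))))).
  { eapply ded_trans; [exact H|now apply ded_double_num]. }
  apply ded_upto_elim with (code (All phi) + code (All phi)) x.
  - eapply ded_cut; [exact Hx|apply ded_summand_upto].
  - intros m _; destruct (Nat.eq_dec m (code phi)) as [->|Hm].
    + now apply ded_ax; left.
    + apply ded_exfalso; eapply ded_num_neq; cycle 1.
      * eapply ded_trans; [apply ded_sym, ded_body_poly; now apply ded_ax; left|].
        apply (ded_weaken _ _ _ Hx), incl_tl, incl_refl.
      * rewrite <- code_All; nia.
Qed.

End Arithmetic.

(** * Iterated truth under the omega-rule *)

Arguments quote : simpl never.
Arguments code : simpl never.

Fixpoint truth_iter {L} (n : nat) (phi : form L) : form L :=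
  match n with 0 => phi | S n => Tr (quote (truth_iter n phi)) end.

Lemma sentence_Tr_quote {L} (phi : form L) : sentence (Tr (quote phi)).
Proof. apply bounded_num. Qed.

Lemma sentence_truth_iter {L} n (phi : form L) :
  sentence phi -> sentence (truth_iter n phi).
Proof. destruct n; [easy|intros _; apply sentence_Tr_quote]. Qed.

Lemma sentence_And {L} (phi psi : form L) :
  sentence phi -> sentence psi -> sentence (And phi psi).
Proof. now repeat split. Qed.

Lemma sentence_Tomega {L} (g : sym L 2) (phi : form L) :
  sentence (Tomega g (quote phi)).
Proof.
  unfold Tomega, quote, sentence; rewrite shift_t_num; simpl.
  repeat split; auto; apply bounded_num.
Qed.

(** The members of [A] are discharged by [ImpI] and then supplied one by one. This later carries an
    omega-derivation over to Sigma, its axioms being derived from one added hypothesis. *)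
Lemma ded_of_prv {L} {S : form L -> Prop} G A phi :
  prv A phi -> (forall psi, In psi A -> ded S G psi) -> ded S G phi.
Proof.
  revert phi; induction A as [|psi A IH]; intros phi H HA.
  - now apply ded_nil; exists nil.
  - apply ded_impE with psi; [apply IH|]; simpl in *; auto using ImpI.
Qed.

Section Truth.

Context {L : signature} {f : nat -> nat -> nat} {f_sym : sym L 2} {sub : term L}
  {Sigma : form L -> Prop}.
Context (f_iterates : iterates_truth L f) (sub_vars : bounded_t 2 sub)
  (Sigma_sentence : forall phi, Sigma phi -> sentence phi)
  (Sigma_Q : forall phi : form L, Q phi -> Sigma phi)
  (Sigma_f : forall n m : nat,
     proves Sigma (Eq (Fn2 f_sym (num n) (num m)) (num (f n m))))
  (Sigma_dot : forall phi : form L, bounded 1 phi -> forall n : nat,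
     proves Sigma (Eq (inst_t (num n) (dot sub phi))
                      (quote (inst (num n) phi))))
  (T_Intro : forall phi : form L, sentence phi ->
     proves Sigma phi -> proves Sigma (Tr (quote phi)))
  (T_Imp : forall phi psi : form L, sentence phi -> sentence psi ->
     proves Sigma (Imp (Tr (quote (Imp phi psi)))
                       (Imp (Tr (quote phi)) (Tr (quote psi)))))
  (UInf : forall phi : form L, bounded 1 phi ->
     proves Sigma (Imp (All (Tr (dot sub phi))) (Tr (quote (All phi))))).
Implicit Types (G : list (form L)) (phi psi chi : form L) (t u x w : term L).

Notation T phi := (Tr (quote phi)).
Notation box phi := (Tomega f_sym (quote phi)).
Notation W := (omega_ext Sigma).

Lemma omega_ext_sentence phi : W phi -> sentence phi.
Proof. intros []; auto. Qed.

Lemma omega_of_ded G phi : ded Sigma G phi -> ded W G phi.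
Proof. intros (A & HA & H); exists A; split; auto using omega_base. Qed.

Lemma ded_T G phi : sentence phi -> ded Sigma nil phi -> ded Sigma G (T phi).
Proof. intros; now apply ded_nil, T_Intro. Qed.

Lemma ded_T_mp G phi psi : sentence phi -> sentence psi ->
  ded Sigma G (T (Imp phi psi)) -> ded Sigma G (T phi) -> ded Sigma G (T psi).
Proof.
  intros Hphi Hpsi H; apply ded_impE; revert H; apply ded_mp; now apply T_Imp.
Qed.

(** T-Intro applies to theorems only, so the implication must be proved without hypotheses; T-Imp
    then lets it act under [G]. *)
Lemma ded_T_mono G phi psi : sentence phi -> sentence psi ->
  ded Sigma nil (Imp phi psi) -> ded Sigma G (T phi) -> ded Sigma G (T psi).
Proof. intros Hphi Hpsi H; apply ded_T_mp, ded_T; auto; now split. Qed.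

Lemma ded_T_and G phi psi : sentence phi -> sentence psi ->
  ded Sigma G (T phi) -> ded Sigma G (T psi) -> ded Sigma G (T (And phi psi)).
Proof.
  intros Hphi Hpsi H; apply ded_T_mp; [easy|now repeat split|].
  revert H; apply ded_T_mono; [easy|now repeat split|].
  apply ded_impI, ded_impI, ded_and; apply ded_ax; simpl; auto.
Qed.

(** ** Substitution and quantification inside quotation *)

(** [dot] fixes the formula by its quotation. Here its code may be any term: psi quantifies over
    codes, and diagonalization feeds in one variable as both arguments. *)
Definition sub2 t u : term L := subst_t (scons t (scons u Var)) sub.

Lemma inst_t_dot t phi : inst_t t (dot sub phi) = sub2 (quote phi) t.
Proof.
  unfold inst_t, dot, sub2; rewrite subst_t_comp.
  apply (subst_t_agree 2); auto.
  intros [|[|x]] Hx; simpl; auto.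
  apply subst_t_num.
Qed.

Lemma dot_sub2 phi : dot sub phi = sub2 (quote phi) (Var 0).
Proof.
  apply (subst_t_agree 2); auto; intros [|[|x]] Hx; simpl; auto; lia.
Qed.

Lemma subst_t_sub2 s t u : subst_t s (sub2 t u) = sub2 (subst_t s t) (subst_t s u).
Proof.
  unfold sub2; rewrite subst_t_comp; apply (subst_t_agree 2); auto.
  intros [|[|x]] Hx; simpl; auto; lia.
Qed.

Lemma bounded_sub2 n t u : bounded_t n t -> bounded_t n u -> bounded_t n (sub2 t u).
Proof.
  intros; apply (bounded_subst_t 2); auto; intros [|[|x]] Hx; simpl; auto; lia.
Qed.

Lemma ded_sub2 G t t' u u' :
  ded Sigma G (Eq t t') -> ded Sigma G (Eq u u') ->
  ded Sigma G (Eq (sub2 t u) (sub2 t' u')).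
Proof.
  intros Ht Hu; apply ded_trans with (sub2 t' u).
  - generalize (ded_congr _ _ _ (sub2 (Var 0) (shift_t u)) Ht).
    unfold inst_t; rewrite !subst_t_sub2; simpl.
    fold (inst_t t (shift_t u)); fold (inst_t t' (shift_t u)).
    now rewrite !inst_t_shift_t.
  - generalize (ded_congr _ _ _ (sub2 (shift_t t') (Var 0)) Hu).
    unfold inst_t; rewrite !subst_t_sub2; simpl.
    fold (inst_t u (shift_t t')); fold (inst_t u' (shift_t t')).
    now rewrite !inst_t_shift_t.
Qed.

Lemma ded_sub2_quote G phi n : bounded 1 phi ->
  ded Sigma G (Eq (sub2 (quote phi) (num n)) (quote (inst (num n) phi))).
Proof.
  intros Hphi; rewrite <- inst_t_dot; now apply ded_nil, Sigma_dot.
Qed.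

Lemma ded_UInf G phi : bounded 1 phi ->
  ded Sigma G (All (Tr (sub2 (quote phi) (Var 0)))) -> ded Sigma G (T (All phi)).
Proof. intros Hphi; rewrite <- dot_sub2; apply ded_mp; now apply UInf. Qed.

(* Only instances of unary formulas can be quoted, so the diagonal lemma with a
   parameter is not available: diagonalization yields a name w of the sentence
   All psi, and psi itself is recovered from w by [body_code]. *)
Lemma self_predecessor A : bounded 1 A -> exists w psi,
  bounded_t 0 w /\
  psi = And A (All (All (Imp (body_code (Var 0) w)
          (Imp (Eq (Succ (Var 1)) (Var 2)) (Tr (sub2 (Var 0) (Var 1))))))) /\
  ded Sigma nil (Eq w (quote (All psi))).
Proof.
  intros HA.
  (* Inside the two quantifiers, [Var 2] is p, [Var 1] is q and [Var 0] is the code of psi recovered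
     from w. *)
  pose (B w := And A (All (All (Imp (body_code (Var 0) w)
          (Imp (Eq (Succ (Var 1)) (Var 2)) (Tr (sub2 (Var 0) (Var 1)))))))).
  (* [Var 3] is the free variable of delta, seen from below three quantifiers. Substituting the
     quotation of delta for it makes w a term for the code of the very sentence that results. *)
  set (delta := All (B (sub2 (Var 3) (Var 3)))).
  assert (Hdelta : bounded 1 delta).
  { simpl; repeat split; try apply bounded_num; try lia;
      try (apply bounded_sub2; simpl; lia); now apply (bounded_mono 1); [lia|]. }
  exists (sub2 (quote delta) (quote delta)), (B (sub2 (quote delta) (quote delta))).
  split; [apply bounded_sub2; apply bounded_num|split; [reflexivity|]].
  replace (All (B (sub2 (quote delta) (quote delta))))
    with (inst (quote delta) delta); [now apply ded_sub2_quote|].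
  unfold quote; generalize (code delta); intros n.
  unfold delta, B, And, Neg, body_code, body_poly, inst.
  cbn -[num sub2]; rewrite !subst_t_sub2; cbn -[num sub2].
  unfold shift_t; rewrite !subst_t_num.
  rewrite (subst_id 1 A); auto; intros [|x]; [easy|lia].
Qed.

(** * Sentences that imply their own truth *)

Lemma inst_predecessor A w t : bounded_t 0 w ->
  inst t (And A (All (All (Imp (body_code (Var 0) w)
    (Imp (Eq (Succ (Var 1)) (Var 2)) (Tr (sub2 (Var 0) (Var 1)))))))) =
  And (inst t A) (All (All (Imp (body_code (Var 0) w)
    (Imp (Eq (Succ (Var 1)) (shift_t (shift_t t))) (Tr (sub2 (Var 0) (Var 1))))))).
Proof.
  intros Hw; unfold inst, And, Neg, body_code, body_poly; cbn -[num sub2].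
  rewrite !subst_t_sub2; cbn -[num sub2].
  now rewrite !(subst_t_closed _ w), !subst_t_num.
Qed.

(** T-Intro does not reach [All A], which only the omega-rule yields. The sentence rho, which is
    [All psi], comes from that rule as well, but Sigma derives [T rho] from it, so that its
    consequences in Sigma can be carried under T. *)
Lemma omega_reflecting A :
  bounded 1 A -> (forall n, ded Sigma nil (inst (num n) A)) ->
  exists rho, sentence rho /\ ded W nil rho /\
    ded Sigma nil (Imp rho (T rho)) /\ ded Sigma nil (Imp rho (All A)).
Proof.
  intros HA Hn.
  destruct (self_predecessor A HA) as (w & psi & Hw & Hpsi & Hquote).
  assert (Hpsi1 : bounded 1 psi).
  { rewrite Hpsi; simpl; repeat split; auto; try lia;
      try (apply (bounded_t_mono 0); [lia|easy]); apply bounded_sub2; simpl; lia. }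
  (* The second conjunct of psi(0) holds because no successor is zero; that of psi(n+1) asks for the
     truth of psi(n), which T-Intro supplies from the induction hypothesis. *)
  assert (Hinst : forall n, ded Sigma nil (inst (num n) psi)).
  { induction n as [|n IH]; rewrite Hpsi, inst_predecessor by easy;
      (apply ded_and; [apply Hn|]);
      do 2 (apply (ded_allI_closed Sigma_sentence); [constructor|]);
      do 2 apply ded_impI; rewrite !shift_t_num.
    - apply ded_exfalso, (ded_succ_zero Sigma_Q _ (Var 1)), ded_ax; now left.
    - apply ded_Tr with (quote (inst (num n) psi)).
      + eapply ded_trans; [now apply ded_sym, ded_sub2_quote|].
        apply ded_sub2; apply ded_sym.
        * apply (ded_body_code_unique Sigma_sentence Sigma_Q) with w;
            [now apply ded_nil|apply ded_ax; simpl; auto].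
        * apply (ded_succ_inj Sigma_Q), ded_ax; now left.
      + apply ded_T; [now apply bounded_inst, bounded_num|easy]. }
  exists (All psi); split; [easy|split; [|split]].
  - apply ded_base; now apply omega_rule.
  - apply ded_impI, ded_UInf; [easy|].
    apply (ded_allI_closed Sigma_sentence); [now repeat constructor|].
    (* With p = x + 1, q = x and the code of psi, the second conjunct gives T of psi(x) for
       arbitrary x, which is the premise of UInf. *)
    assert (H : ded Sigma (All psi :: nil) (inst (Succ (Var 0)) psi))
      by now apply ded_allE, ded_ax; left.
    rewrite Hpsi in H at 2; rewrite inst_predecessor in H by easy.
    apply ded_and_r, (ded_allE _ _ (Var 0)) in H.
    unfold inst in H; cbn [subst] in H.
    apply (ded_allE _ _ (quote psi)) in H.
    unfold inst, body_code, body_poly in H; cbn -[num sub2] in H.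
    rewrite !subst_t_sub2 in H; cbn -[num sub2] in H.
    rewrite !(subst_t_closed _ w), !subst_t_num in H by easy.
    exact (ded_impE _ _ _ (ded_impE _ _ _ H
      (ded_body_code_quote Sigma_Q _ _ _ (ded_nil _ _ Hquote))) (ded_refl _ _)).
  - apply ded_impI, (ded_allI_closed Sigma_sentence); [now repeat constructor|].
    rewrite <- (inst_Var0 A) by easy.
    apply ded_and_l with (All (All (Imp (body_code (Var 0) w)
      (Imp (Eq (Succ (Var 1)) (shift_t (shift_t (Var 0))))
        (Tr (sub2 (Var 0) (Var 1))))))).
    rewrite <- inst_predecessor, <- Hpsi by easy.
    now apply ded_allE, ded_ax; left.
Qed.

(** A derivation uses finitely many axioms. Those in Sigma cost nothing, those from the omega-rule
    each have a reflecting sentence, and a conjunction of sentences that imply their own truth does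
    so again. *)
Lemma omega_proof_reflecting chi :
  ded W nil chi ->
  exists rho, sentence rho /\ ded W nil rho /\
    ded Sigma nil (Imp rho (T rho)) /\ ded Sigma nil (Imp rho chi).
Proof.
  intros (A & HA & Hchi); simpl in Hchi.
  assert (H : exists rho, sentence rho /\ ded W nil rho /\
    ded Sigma nil (Imp rho (T rho)) /\
    forall psi, In psi A -> ded Sigma (rho :: nil) psi).
  { clear Hchi; induction A as [|psi A IH].
    (* The empty conjunction. *)
    - exists (Imp Bot Bot); split; [now split|].
      assert (H : forall S, ded S nil (Imp (Bot : form L) Bot))
        by (intros; apply ded_impI, ded_ax; now left).
      repeat split; auto; [|easy].
      apply ded_impI, ded_T; auto; now split.
    - destruct IH as (rho & Hrho & HW & HT & HrhoA); [intros; apply HA; now right|].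
      destruct (HA psi) as [psi Hpsi|psi Hpsi Hinst]; [now left| |].
      + exists rho; repeat split; auto; intros phi [<-|]; auto using ded_base.
      + destruct (omega_reflecting psi Hpsi Hinst) as (rho' & Hrho' & HW' & HT' & Hall).
        exists (And rho' rho).
        assert (Hl : forall G, In (And rho' rho) G -> ded Sigma G rho')
          by (intros; apply ded_and_l with rho; now apply ded_ax).
        assert (Hr : forall G, In (And rho' rho) G -> ded Sigma G rho)
          by (intros; apply ded_and_r with rho'; now apply ded_ax).
        split; [now repeat split|split; [now apply ded_and|split]].
        * apply ded_impI, ded_T_and; auto; [apply (ded_mp _ _ _ HT')|apply (ded_mp _ _ _ HT)];
            [apply Hl|apply Hr]; now left.
        * intros phi [<-|Hphi].
          -- apply (ded_mp _ _ _ Hall), Hl; now left.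
          -- apply ded_cut with rho; [apply Hr; now left|].
             apply (ded_weaken _ _ _ (HrhoA _ Hphi)); intros x; simpl; tauto. }
  destruct H as (rho & Hrho & HW & HT & HA'); exists rho; repeat split; auto.
  apply ded_impI, (ded_of_prv _ _ _ Hchi), HA'.
Qed.

(** * Iterated truth and the function f *)

Lemma f_truth_iter n phi :
  sentence phi -> f n (code phi) = code (truth_iter n phi).
Proof.
  destruct f_iterates as [H0 HSucc]; intros Hphi.
  induction n as [|n IH]; simpl; auto using sentence_truth_iter.
Qed.

Lemma ded_f_truth_iter G n phi : sentence phi ->
  ded Sigma G (Eq (Fn2 f_sym (num n) (quote phi)) (quote (truth_iter n phi))).
Proof.
  intros Hphi; unfold quote; rewrite <- f_truth_iter by easy.
  apply ded_nil, Sigma_f.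
Qed.

Lemma box_All phi : box phi = All (Tr (Fn2 f_sym (Var 0) (quote phi))).
Proof. unfold Tomega, quote; now rewrite shift_t_num. Qed.

Lemma inst_box_body phi t :
  inst t (Tr (Fn2 f_sym (Var 0) (quote phi))) = Tr (Fn2 f_sym t (quote phi)).
Proof. unfold inst, quote; simpl; now rewrite subst_t_num. Qed.

Lemma bounded_box_body phi : bounded 1 (Tr (Fn2 f_sym (Var 0) (quote phi))).
Proof. simpl; repeat split; auto; apply bounded_num. Qed.

(** T^omega is read off one numeral at a time. Its instance at 0 is [T phi] and not phi, so the
    instance at n carries n + 1 applications of T. *)
Lemma ded_box_elim G phi n : sentence phi ->
  ded Sigma G (box phi) -> ded Sigma G (T (truth_iter n phi)).
Proof.
  intros Hphi H; eapply ded_Tr; [now apply ded_f_truth_iter|].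
  rewrite <- inst_box_body; apply ded_allE; now rewrite <- box_All.
Qed.

Lemma omega_box_intro chi phi : sentence chi -> sentence phi ->
  (forall n, ded Sigma nil (Imp chi (T (truth_iter n phi)))) ->
  ded W nil (Imp chi (box phi)).
Proof.
  intros Hchi Hphi H; apply ded_impI; rewrite box_All.
  apply (ded_allI_closed omega_ext_sentence); [now repeat constructor|].
  apply ded_impE with chi; [|now apply ded_ax; left].
  (* The premises of the omega-rule must be theorems of Sigma, so chi goes into the formula to be
     generalized instead of staying among the hypotheses. *)
  pose (psi := Imp chi (Tr (Fn2 f_sym (Var 0) (quote phi)))).
  assert (Hpsi : bounded 1 psi).
  { split; [now apply (bounded_mono 0); [lia|]|apply bounded_box_body]. }
  change (ded W (chi :: nil) psi); rewrite <- (inst_Var0 psi) by easy.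
  apply ded_allE, ded_base, omega_rule; [easy|]; intros n.
  change (ded Sigma nil (Imp (inst (num n) chi)
    (inst (num n) (Tr (Fn2 f_sym (Var 0) (quote phi)))))).
  rewrite inst_box_body, inst_sentence by easy.
  apply ded_impI; eapply ded_Tr; [now apply ded_sym, ded_f_truth_iter|].
  apply (ded_mp _ _ _ (H n)); now apply ded_ax; left.
Qed.

(** Once rho -> T^n phi is a theorem, monotonicity gives T rho -> T^(n+1) phi, and rho -> T rho
    closes the induction. *)
Lemma ded_truth_iter_fixed rho phi n : sentence rho -> sentence phi ->
  ded Sigma nil (Imp rho (T rho)) -> ded Sigma nil (Imp rho phi) ->
  ded Sigma nil (Imp rho (T (truth_iter n phi))).
Proof.
  intros Hrho Hphi HT H; apply ded_impI.
  assert (HTrho : ded Sigma (rho :: nil) (T rho))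
    by (apply (ded_mp _ _ _ HT); now apply ded_ax; left).
  revert HTrho; apply ded_T_mono; auto using sentence_truth_iter.
  induction n as [|n IH]; [easy|]; simpl; apply ded_impI.
  apply (ded_T_mono _ rho); auto using sentence_truth_iter.
  apply (ded_mp _ _ _ HT); now apply ded_ax; left.
Qed.

Lemma ded_truth_iter_mp G phi psi n : sentence phi -> sentence psi ->
  ded Sigma G (Imp (truth_iter n (Imp phi psi))
                (Imp (truth_iter n phi) (truth_iter n psi))).
Proof.
  intros Hphi Hpsi; revert G; induction n as [|n IH]; intros G; simpl.
  - apply ded_impI, ded_ax; now left.
  - assert (Himp : sentence (Imp phi psi)) by now split.
    pose proof (sentence_truth_iter n _ Hphi).
    pose proof (sentence_truth_iter n _ Hpsi).
    do 2 apply ded_impI; eapply ded_T_mp; [| | |now apply ded_ax; left]; auto.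
    eapply ded_T_mono; [| |apply IH|now apply ded_ax; right; left]; auto.
    + now apply sentence_truth_iter.
    + now split.
Qed.

(** ** Provability conditions for iterated truth *)

(** The implications rho -> T^(n+1) phi to which the omega-rule is applied are theorems of Sigma;
    rho, which may itself rest on the rule, is detached only afterwards, so no application feeds
    another. *)
Lemma omega_necessitation phi : sentence phi -> ded W nil phi -> ded W nil (box phi).
Proof.
  intros Hphi H.
  destruct (omega_proof_reflecting phi H) as (rho & Hrho & HW & HT & Hrhophi).
  apply ded_impE with rho; [|easy].
  apply omega_box_intro; auto; intros n; now apply ded_truth_iter_fixed.
Qed.

(** For each n, Sigma derives T^(n+1) psi from the two boxes by T-Imp under iterated T; the
    omega-rule then collects the results. *)
Lemma omega_distribution G phi psi : sentence phi -> sentence psi ->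
  ded W G (box (Imp phi psi)) -> ded W G (box phi) -> ded W G (box psi).
Proof.
  intros Hphi Hpsi H H'.
  assert (Himp : sentence (Imp phi psi)) by now split.
  apply ded_mp with (And (box (Imp phi psi)) (box phi)); [|now apply ded_and].
  apply omega_box_intro; [apply sentence_And; apply sentence_Tomega|easy|].
  intros n; apply ded_impI.
  assert (H0 : ded Sigma (And (box (Imp phi psi)) (box phi) :: nil)
                 (And (box (Imp phi psi)) (box phi))) by now apply ded_ax; left.
  apply ded_impE with (truth_iter (S n) phi);
    [apply ded_impE with (truth_iter (S n) (Imp phi psi));
      [now apply ded_truth_iter_mp|]|]; apply ded_box_elim; auto.
  - now apply ded_and_l in H0.
  - now apply ded_and_r in H0.
Qed.

(* Sigma knows the recursion equation of f only numeral by numeral, so already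
   the step from box phi to T (box phi) needs the omega-rule; having a rho with
   rho -> T rho imply its conclusion lets the step be iterated inside T. *)
Lemma omega_transitivity G phi :
  sentence phi -> ded W G (box phi) -> ded W G (box (box phi)).
Proof.
  intros Hphi; apply ded_mp.
  pose (B := Tr (Fn2 f_sym (Var 0) (quote phi))).
  pose proof (bounded_box_body phi : bounded 1 B) as HB.
  assert (Hbox : sentence (box phi)) by apply sentence_Tomega.
  (* Both sides say that T^(t+1) phi is true; on the right it is written as the instance of [B] at
     t, the form that UInf can use. At numerals the values of f are provable, so each instance is a
     theorem. *)
  pose (step t := Imp (Tr (Fn2 f_sym (Succ t) (quote phi))) (Tr (sub2 (quote B) t))).
  assert (Hstep : forall t, inst t (step (Var 0)) = step t).
  { intros t; unfold inst, step, quote; cbn -[num sub2].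
    rewrite subst_t_sub2; cbn -[num sub2]; now rewrite !subst_t_num. }
  destruct (omega_reflecting (step (Var 0))) as (rho & Hrho & HW & HT & Hall).
  { simpl; repeat split; auto; try apply bounded_num.
    apply bounded_sub2; [apply bounded_num|simpl; lia]. }
  { intros n; rewrite Hstep; unfold step; apply ded_impI.
    eapply ded_Tr; [now apply ded_sym, ded_sub2_quote|].
    unfold B; rewrite inst_box_body.
    apply (ded_T_mono _ (truth_iter (S n) phi)).
    - now apply sentence_truth_iter.
    - simpl; repeat split; auto; apply bounded_num.
    - apply ded_impI; eapply ded_Tr; [now apply ded_sym, ded_f_truth_iter|].
      now apply ded_ax; left.
    - eapply ded_Tr; [now apply (ded_f_truth_iter _ (S n))|].
      now apply ded_ax; left. }
  assert (HX : forall G, In (And rho (box phi)) G -> ded Sigma G rho /\ ded Sigma G (box phi)).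
  { intros G' HG; split; [apply ded_and_l with (box phi)|apply ded_and_r with rho];
      now apply ded_ax. }
  (* The conjunction implies its own truth: box phi at x + 1 and [step] at x give T of B(x), and
     UInf turns this into T of box phi. As it also implies box phi, it implies every T^n of box
     phi. *)
  assert (H : ded W nil (Imp (And rho (box phi)) (box (box phi)))).
  { apply omega_box_intro; [now apply sentence_And|easy|]; intros n.
    apply ded_truth_iter_fixed; [now apply sentence_And|easy| |].
    - destruct (HX (And rho (box phi) :: nil)) as [H1 H2]; [now left|].
      apply ded_impI, ded_T_and; auto; [now apply (ded_mp _ _ _ HT)|].
      rewrite box_All at 2; apply ded_UInf; [easy|].
      apply (ded_allI_closed Sigma_sentence).
      { constructor; [now apply sentence_And|constructor]. }
      apply ded_impE with (Tr (Fn2 f_sym (Succ (Var 0)) (quote phi))).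
      + change (ded Sigma (And rho (box phi) :: nil) (step (Var 0))).
        rewrite <- Hstep; now apply ded_allE, (ded_mp _ _ _ Hall).
      + rewrite <- inst_box_body; apply ded_allE; now rewrite <- box_All.
    - apply ded_impI, HX; now left. }
  apply ded_impI, (ded_mp _ _ _ H), ded_and; [now apply ded_nil|now apply ded_ax; left].
Qed.

(** The fixed point of Loeb's argument. Syntactically gamma speaks of the term d, which Sigma proves
    equal to the quotation of gamma, so both directions come by rewriting with this equation. *)
Lemma loeb_sentence phi : sentence phi -> exists gamma : form L, sentence gamma /\
  (forall G, ded W G (Imp gamma (Imp (box gamma) phi))) /\
  (forall G, ded W G (Imp (Imp (box gamma) phi) gamma)).
Proof.
  intros Hphi.
  set (delta := Imp (Tomega f_sym (sub2 (Var 0) (Var 0))) phi).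
  set (d := sub2 (quote delta) (quote delta)).
  assert (Hdelta : bounded 1 delta).
  { unfold delta, Tomega, shift_t; simpl; rewrite subst_t_sub2; repeat split; auto; simpl.
    - apply bounded_sub2; simpl; lia.
    - now apply (bounded_mono 0); [lia|]. }
  assert (Hd : bounded_t 0 d) by (apply bounded_sub2; apply bounded_num).
  assert (Hgamma : inst (quote delta) delta = Imp (Tomega f_sym d) phi).
  { unfold delta at 2, d, Tomega, inst, quote, shift_t; generalize (code delta); intros n.
    cbn -[num sub2]; rewrite !subst_t_sub2; cbn -[num sub2].
    unfold shift_t; rewrite !subst_t_num.
    now fold (inst (num n) phi); rewrite inst_sentence. }
  assert (Heq : ded Sigma nil (Eq d (quote (Imp (Tomega f_sym d) phi))))
    by (rewrite <- Hgamma; now apply ded_sub2_quote).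
  assert (Hrw : forall G t u, ded Sigma G (Eq t u) ->
    ded Sigma G (Tomega f_sym t) -> ded Sigma G (Tomega f_sym u)).
  { intros G t u Htu H; generalize (ded_rewrite _ _ _ (Tomega f_sym (Var 0)) Htu).
    unfold inst; simpl; intros H'; now apply H'. }
  exists (Imp (Tomega f_sym d) phi); split; [|split; intros G; apply omega_of_ded].
  - split; [|easy]; unfold Tomega, shift_t; rewrite subst_t_closed by easy.
    simpl; repeat split; auto; now apply (bounded_t_mono 0); [lia|].
  - do 2 apply ded_impI; apply ded_impE with (Tomega f_sym d); [apply ded_ax; simpl; auto|].
    apply (Hrw _ _ _ (ded_nil _ _ (ded_sym _ _ _ Heq))); now apply ded_ax; left.
  - do 2 apply ded_impI; eapply ded_impE; [apply ded_ax; right; now left|].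
    apply (Hrw _ _ _ (ded_nil _ _ Heq)); now apply ded_ax; left.
Qed.

Lemma omega_loeb phi : sentence phi ->
  (ded W nil (Imp (box phi) phi) -> ded W nil phi) /\
  ded W nil (Imp (box (Imp (box phi) phi)) (box phi)).
Proof.
  intros Hphi; destruct (loeb_sentence phi Hphi) as (gamma & Hgamma & Hout & Hin).
  pose proof (sentence_Tomega f_sym phi : sentence (box phi)) as Hboxphi.
  pose proof (sentence_Tomega f_sym gamma : sentence (box gamma)) as Hbox.
  assert (Himp : sentence (Imp (box gamma) phi)) by now split.
  (* Boxing gamma -> (box gamma -> phi) gives box gamma -> (box box gamma -> box phi), and
     transitivity supplies the middle box. *)
  assert (H : forall G, ded W G (box gamma) -> ded W G (box phi)).
  { intros G H; apply omega_distribution with (box gamma); auto.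
    - apply omega_distribution with gamma; auto.
      apply ded_nil, omega_necessitation; [now split|apply Hout].
    - now apply omega_transitivity. }
  split; [intros Hrefl|apply ded_impI].
  (* From box gamma come box phi and, by the assumption, phi; hence gamma holds and can be
     necessitated. *)
  - assert (Hg : ded W nil gamma).
    { apply (ded_impE _ _ _ (Hin nil)), ded_impI, (ded_mp _ _ _ Hrefl), H.
      now apply ded_ax; left. }
    apply (ded_impE _ _ _ Hrefl), H; now apply omega_necessitation.
  (* The first claim's argument runs under the box: (box phi -> phi) -> gamma is omega-provable, so
     necessitation and distribution lead from the box of its premise to box gamma. *)
  - apply H, omega_distribution with (Imp (box phi) phi);
      [now split|easy| |now apply ded_ax; left].
    apply ded_nil, omega_necessitation; [split; [now split|easy]|].
    apply ded_impI, (ded_impE _ _ _ (Hin _)), ded_impI.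
    apply ded_impE with (box phi); [apply ded_ax; simpl; auto|].
    apply H; now apply ded_ax; left.
Qed.

End Truth.

Theorem theorem2 (L : signature)
  (f : nat -> nat -> nat) (f_sym : sym L 2) (sub : term L)
  (Sigma : form L -> Prop)
  (f_primrec : primrec2 f)
  (f_iterates : iterates_truth L f)
  (sub_vars : bounded_t 2 sub)
  (Sigma_theory : theory Sigma)
  (Sigma_Q : forall phi : form L, Q phi -> Sigma phi)
  (Sigma_f : forall n m : nat,
     proves Sigma (Eq (Fn2 f_sym (num n) (num m)) (num (f n m))))
  (Sigma_dot : forall phi : form L, bounded 1 phi -> forall n : nat,
     proves Sigma (Eq (inst_t (num n) (dot sub phi))
                      (quote (inst (num n) phi))))
  (T_Intro : forall phi : form L, sentence phi ->
     proves Sigma phi -> proves Sigma (Tr (quote phi)))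
  (T_Imp : forall phi psi : form L, sentence phi -> sentence psi ->
     proves Sigma (Imp (Tr (quote (Imp phi psi)))
                       (Imp (Tr (quote phi)) (Tr (quote psi)))))
  (UInf : forall phi : form L, bounded 1 phi ->
     proves Sigma (Imp (All (Tr (dot sub phi))) (Tr (quote (All phi))))) :
  forall phi : form L, sentence phi ->
    (proves_omega Sigma (Imp (Tomega f_sym (quote phi)) phi) ->
     proves_omega Sigma phi) /\
    proves_omega Sigma
      (Imp (Tomega f_sym (quote (Imp (Tomega f_sym (quote phi)) phi)))
           (Tomega f_sym (quote phi))).
Proof.
  intros phi; apply (omega_loeb f_iterates sub_vars (proj1 Sigma_theory) Sigma_Q
    Sigma_f Sigma_dot T_Intro T_Imp UInf).
Qed.
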